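(* Let $\lambda$ be a partition with $|\lambda|=N$ and let $n\ge N$. For every $T\in\mathsf{SYT}(\lambda)$, the edges of the crystal skeleton $\mathsf{CS}(\lambda)$ leaving $T$ are in bijection with the Dyck pattern intervals of $\mathsf{row}(T)$; consequently the edges of $\mathsf{CS}(\lambda)$ are in bijection with the pairs $(T,I)$ where $T\in\mathsf{SYT}(\lambda)$ and $I$ is a Dyck pattern interval occurring in $\mathsf{row}(T)$.
   Context: Partitions and Young tableaux are drawn in French notation (row lengths weakly decrease from bottom to top). For a partition $\lambda$ with $|\lambda|=N$, $\mathsf{SYT}(\lambda)$ denotes the standard Young tableaux of shape $\lambda$ (entries $1,\dots,N$) and $\mathsf{SSYT}(\lambda)_n$ the semistandard Young tableaux of shape $\lambda$ with entries in $[n]=\{1,\dots,n\}$. The reading word $\mathsf{row}(b)$ of a tableau reads each row left to right, starting with the top row and ending with the bottom row. If $b$ has $a_j$ entries equal to $j$, its standardization $\mathsf{std}(b)$ replaces the entries equal to $j$, in reading-word order, by $a_1+\dots+a_{j-1}+1,\dots,a_1+\dots+a_j$; it is a standard tableau of the same shape. The crystal $B(\lambda)_n$ is the set $\mathsf{SSYT}(\lambda)_n$ with operators $f_i,e_i$ ($1\le i<n$) defined as follows: in the subword of $\mathsf{row}(b)$ consisting of the letters $i$ and $i+1$, successively bracket each letter $i+1$ with an unbracketed letter $i$ to its right (as with parentheses, $i+1$ opening and $i$ closing); the unbracketed letters form a word $i^r(i+1)^s$; $f_i$ changes the rightmost unbracketed $i$ to $i+1$ ($f_i(b)=\emptyset$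 if $r=0$) and $e_i$ changes the leftmost unbracketed $i+1$ to $i$ ($e_i(b)=\emptyset$ if $s=0$); other letters are unchanged. For $T\in\mathsf{SYT}(\lambda)$ the quasi-crystal is $Q_T=\{b\in B(\lambda)_n:\mathsf{std}(b)=T\}$. The crystal skeleton $\mathsf{CS}(\lambda)$ is the directed graph with vertex set $\mathsf{SYT}(\lambda)$ with an edge $T\to T'$ (for $T\ne T'$) whenever there are $b\in Q_T$, $b'\in Q_{T'}$ and $1\le i<n$ with $f_i(b)=b'$. For a permutation $\pi$ of $[N]$ and an interval $I=[i,i+2m]\subseteq[N]$ with $m\ge 1$, let $\pi|_I$ be the subword of $\pi$ consisting of the letters in $I$; $I$ is a Dyck pattern interval of $\pi$ if the RSK insertion tableau $P(\pi|_I)$ has bottom row $i,i+1,\dots,i+m$ and top row $i+m+1,\dots,i+2m$. *)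

(* Defs.v *)
From mathcomp Require Import all_boot.
Set Implicit Arguments. Unset Strict Implicit. Unset Printing Implicit Defensive.

(* Tableaux in French notation: a tableau is a list of rows, row 0 being the
   BOTTOM (longest) row; each row is read left to right. *)
Definition tableau := seq (seq nat).

Definition is_partition (lam : seq nat) : bool :=
  sorted geq lam && all (fun k => 0 < k) lam.

Definition shape (t : tableau) : seq nat := map size t.

Definition is_tableau (lam : seq nat) (t : tableau) : Prop :=
  shape t = lam /\
  (forall r, sorted leq (nth [::] t r)) /\
  (forall r j, j < size (nth [::] t r.+1) ->
     nth 0 (nth [::] t r) j < nth 0 (nth [::] t r.+1) j).

Definition is_SYT (lam : seq nat) (t : tableau) : Prop :=
  is_tableau lam t /\ perm_eq (flatten t) (iota 1 (sumn lam)).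

Definition is_SSYT (lam : seq nat) (n : nat) (t : tableau) : Prop :=
  is_tableau lam t /\ all (fun x => (1 <= x <= n)) (flatten t).

Definition row_word (t : tableau) : seq nat := flatten (rev t).

Definition tableau_of_word (sh : seq nat) (w : seq nat) : tableau :=
  rev (reshape (rev sh) w).

(* standardization of a word: the letters equal to j, in order, become
   a_1+...+a_{j-1}+1, ..., a_1+...+a_j *)
Definition std_word (w : seq nat) : seq nat :=
  [seq count (fun y => y < nth 0 w k) w
       + count (pred1 (nth 0 w k)) (take k w) + 1 | k <- iota 0 (size w)].

Definition std (b : tableau) : tableau :=
  tableau_of_word (shape b) (std_word (row_word b)).

(* positions (0-based) of the unbracketed letters i in w, where each i+1
   is bracketed with an unbracketed i to its right (i+1 opens, i closes);
   c counts the currently open (unbracketed so far) letters i+1 *)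
Fixpoint unbr_i (i c k : nat) (w : seq nat) : seq nat :=
  match w with
  | [::] => [::]
  | x :: w' =>
      if x == i.+1 then unbr_i i c.+1 k.+1 w'
      else if x == i then
        (if 0 < c then unbr_i i c.-1 k.+1 w' else k :: unbr_i i c k.+1 w')
      else unbr_i i c k.+1 w'
  end.

Definition f_word (i : nat) (w : seq nat) : option (seq nat) :=
  match rev (unbr_i i 0 0 w) with
  | [::] => None
  | k :: _ => Some (set_nth 0 w k i.+1)
  end.

(* f_i on tableaux (None plays the role of the empty symbol) *)
Definition crystal_f (i : nat) (b : tableau) : option tableau :=
  omap (tableau_of_word (shape b)) (f_word i (row_word b)).

Definition CS_edge (lam : seq nat) (n : nat) (T T' : tableau) : Prop :=
  is_SYT lam T /\ is_SYT lam T' /\ T <> T' /\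
  exists (b b' : tableau) (i : nat),
    [/\ 1 <= i < n,
        is_SSYT lam n b /\ std b = T,
        is_SSYT lam n b' /\ std b' = T' &
        crystal_f i b = Some b'].

Fixpoint rs_insert (t : tableau) (x : nat) : tableau :=
  match t with
  | [::] => [:: [:: x]]
  | r :: t' =>
      let k := find (fun y => x < y) r in
      if k < size r then set_nth 0 r k x :: rs_insert t' (nth 0 r k)
      else rcons r x :: t'
  end.

Definition P_tab (w : seq nat) : tableau := foldl rs_insert [::] w.

(* I = [i, i+2m] (encoded as the pair (i, m)) is a Dyck pattern interval of
   the permutation pi of [N], N = size pi *)
Definition dyck_interval (pi : seq nat) (I : nat * nat) : Prop :=
  let: (i, m) := I in
  [/\ 1 <= i, 1 <= m, i + 2 * m <= size pi &
      P_tab [seq x <- pi | i <= x <= i + 2 * m]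
        = [:: iota i m.+1; iota (i + m + 1) m]].

(* Main.v *)
Require Import Defs.
From mathcomp Require Import all_boot zify.
From Stdlib Require Import ClassicalEpsilon ProofIrrelevance.
Set Implicit Arguments. Unset Strict Implicit. Unset Printing Implicit Defensive.

(* Let [w] be the reading word of [b], [t] that of [T = std b], and let [f_i]
   raise the letter at index [k].  Let [c] be the number of [i+1] left of [k] and
   [d] the number of [i] right of [k].  Raising the letter at [k] adds [m = c + d]
   to the entry [t_k] of the standardization and lowers by one the [m] entries
   that follow it, so that the edge [T -> T'] determines [k], [m] and [c].
   All the [i+1] left of [k] and all the [i] right of [k] are bracketed, and the
   interval [[t_k - c, t_k - c + 2m]] consists of [t_k] and of the standardized
   values of [c + d] disjoint bracketed pairs: it is a Dyck pattern interval.
   Conversely, collapsing the two halves of a Dyck pattern interval of [t] to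
   the letters [i] and [i+1] gives a word whose standardization is [t] and to
   which [f_i] applies.

   Semistandardness is read off the standardization, and row insertion of a
   shuffle of two increasing words is the bracketing rule: hence Dyck pattern
   intervals are those in which every letter of the upper half is bracketed. *)

(** * Bracketing *)

Section Counting.
Implicit Types (a b : pred nat) (j k l n : nat).

(** Brackets are counted on index ranges rather than subwords, so that prefixes, suffixes and
    factors obey one additive rule. *)
Definition cnt a j k : nat := \sum_(j <= l < k) (a l : nat).

Lemma cntxx a j : cnt a j j = 0.
Proof. by rewrite /cnt big_geq. Qed.

Lemma cnt_cat a k j n : j <= k -> k <= n -> cnt a j n = cnt a j k + cnt a k n.
Proof. by move=> jk kn; rewrite /cnt (big_cat_nat jk kn). Qed.

Lemma cntSr a j n : j <= n -> cnt a j n.+1 = cnt a j n + a n.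
Proof. by move=> jn; rewrite /cnt big_nat_recr. Qed.

Lemma cntSl a j n : j < n -> cnt a j n = a j + cnt a j.+1 n.
Proof. by move=> jn; rewrite /cnt big_ltn. Qed.

Lemma cnt_le a j n : cnt a j n <= n - j.
Proof.
rewrite /cnt -[leqRHS]muln1 -sum_nat_const_nat.
by apply: leq_sum => l _; case: (a l).
Qed.

Lemma sub_cnt a b j n :
  (forall l, j <= l < n -> a l -> b l) -> cnt a j n <= cnt b j n.
Proof.
move=> ab; rewrite /cnt !big_nat; apply: leq_sum => l /ab.
by case: (a l) => // /(_ isT) ->.
Qed.

Lemma eq_cnt a b j n :
  (forall l, j <= l < n -> a l = b l) -> cnt a j n = cnt b j n.
Proof. by move=> ab; rewrite /cnt; apply: eq_big_nat => l /ab ->. Qed.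

Lemma cnt0 a j n : (forall l, j <= l < n -> ~~ a l) -> cnt a j n = 0.
Proof.
by move=> a0; rewrite /cnt big_nat big1 // => l /a0; case: (a l).
Qed.

Lemma cnt_all a j n : (forall l, j <= l < n -> a l) -> cnt a j n = n - j.
Proof.
move=> a1; rewrite (@eq_cnt _ predT) => [|l /a1 -> //].
by rewrite /cnt sum_nat_const_nat muln1.
Qed.

Lemma cntU a b j n : (forall l, j <= l < n -> a l -> ~~ b l) ->
  cnt (fun l => a l || b l) j n = cnt a j n + cnt b j n.
Proof.
move=> ab; rewrite /cnt -big_split /=; apply: eq_big_nat => l /ab.
by case: (a l) (b l) => [] [] //= /(_ isT).
Qed.

Lemma cnt_gt0 a j n l : j <= l < n -> a l -> 0 < cnt a j n.
Proof.
move=> /andP [jl ln] al.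
by rewrite (@cnt_cat a l) ?(@cntSl a l) ?al //; lia.
Qed.

Lemma cnt_shrink a j k n n' : j <= k -> n <= n' -> cnt a k n <= cnt a j n'.
Proof.
move=> jk nn; case: (leqP k n) => kn; last by rewrite /cnt big_geq // ltnW.
by rewrite (@cnt_cat a k j n') 1?(@cnt_cat a n k n'); lia.
Qed.

Lemma count_cnt (P : pred nat) (w : seq nat) k : k <= size w ->
  count P (take k w) = cnt (fun l => P (nth 0 w l)) 0 k.
Proof.
move=> kw; rewrite -sum1_count big_mkcond (big_nth 0) size_takel //=.
by apply: eq_big_nat => l /andP [_ lk]; rewrite nth_take //; case: (P _).
Qed.

End Counting.

(* An index [l] with [b l] is an opening bracket, one with [a l] a closing one;
   [bal] is the number of brackets that remain open after the first [n]
   indices, [lastu] the last unmatched closing bracket before [n]. *)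
Section Brackets.
Variables a b : pred nat.
Hypothesis abF : forall l, a l -> ~~ b l.

Fixpoint bal n : nat :=
  if n is l.+1 then
    if b l then (bal l).+1 else if a l then (bal l).-1 else bal l
  else 0.

Fixpoint lastu n : option nat :=
  if n is l.+1 then
    if a l && (bal l == 0) then Some l else lastu l
  else None.

(** The last unmatched closing bracket, described without a matching: nothing is open on arrival at
    [k], and no factor starting just after [k] has a surplus of closing brackets. *)
Definition unbr_last n k : Prop :=
  [/\ k < n, a k,
      forall j, j <= k -> cnt b j k <= cnt a j k &
      forall j, k < j <= n -> cnt a k.+1 j <= cnt b k.+1 j].

(** An opening bracket in [[j, n)] is either matched inside that range or still open at [n]. *)
Lemma bal_suffix n j : j <= n -> cnt b j n <= cnt a j n + bal n.
Proof.
elim: n j => [|n IH] j; first by rewrite leqn0 => /eqP ->; rewrite !cntxx.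
rewrite leq_eqVlt => /orP [/eqP ->|]; first by rewrite !cntxx.
rewrite ltnS => jn; rewrite !cntSr //=; move: (IH j jn) (@abF n).
by case: (a n); case: (b n) => [|] /=; try lia; move=> ? /(_ isT).
Qed.

(** The equation strengthens the induction: after the last unmatched closing bracket every closing
    one is matched, so the surplus of openings is exactly [bal n], and the inequality at the next
    index follows. *)
Lemma lastuP n :
  match lastu n with
  | Some k => unbr_last n k /\ bal n + cnt a k.+1 n = cnt b k.+1 n
  | None => (forall j, j <= n -> cnt a 0 j <= cnt b 0 j)
            /\ bal n + cnt a 0 n = cnt b 0 n
  end.
Proof.
elim: n => [|n IH] /=.
  by split; rewrite ?cntxx // => j; rewrite leqn0 => /eqP ->; rewrite !cntxx.
case: ifP => [/andP [an /eqP bn0]|abn].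
  rewrite (negbTE (abF an)) an bn0; split; last by rewrite !cntxx.
  split=> // [j jn|j jn]; last by rewrite (_ : j = n.+1) ?cntxx //; lia.
  by have := bal_suffix jn; rewrite bn0 addn0.
case: (lastu n) IH => [k [[kn ak U1 U2] e]|[U e]].
  (* A closing bracket at [n] now meets [bal n > 0], so the predecessor is not truncated. *)
  have e' : (if b n then (bal n).+1 else if a n then (bal n).-1 else bal n)
     + cnt a k.+1 n.+1 = cnt b k.+1 n.+1.
    rewrite !cntSr //; move: abn (@abF n).
    by case: (a n); case: (b n); case: (bal n =P 0) => //=; try lia;
       move=> ? ? /(_ isT).
  split=> //; split=> // [|j /andP [kj]]; first exact: ltnW.
  rewrite leq_eqVlt => /orP [/eqP ->|jn]; last by apply: U2; lia.
  by rewrite -e' leq_addl.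
have e' : (if b n then (bal n).+1 else if a n then (bal n).-1 else bal n)
     + cnt a 0 n.+1 = cnt b 0 n.+1.
  rewrite !cntSr //; move: abn (@abF n).
  by case: (a n); case: (b n); case: (bal n =P 0) => //=; try lia;
     move=> ? ? /(_ isT).
split=> // j; rewrite leq_eqVlt => /orP [/eqP ->|jn]; last by apply: U; lia.
by rewrite -e' leq_addl.
Qed.

(** If [k < k'], the range strictly between them has at most as many openings as closings, while
    adding the closing bracket [k'] must still leave no surplus of closings. *)
Lemma unbr_last_inj n k k' : unbr_last n k -> unbr_last n k' -> k = k'.
Proof.
wlog lt: k k' / k < k' => [hw|].
  by case: (ltngtP k k') => // lt uk uk'; [|symmetry]; apply: hw lt _ _.
case=> kn ak _ U2 [kn' ak' U1' _].
have := U2 k'.+1; have := U1' k.+1; rewrite !cntSr // ak' (negbTE (abF ak')).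
by move=> /(_ lt) ? /(_ ltac:(lia)); lia.
Qed.

Lemma lastu_unbr n k : lastu n = Some k <-> unbr_last n k.
Proof.
split=> [e|u]; first by have := lastuP n; rewrite e => -[].
have := lastuP n; case: (lastu n) => [k' [/(unbr_last_inj u) -> _] //|[U _]].
case: u => kn ak /(_ 0 isT) U1 _.
by have := U k.+1 kn; rewrite !cntSr // ak (negbTE (abF ak)); lia.
Qed.

Lemma bal_eq0 n : bal n = 0 <-> forall j, j <= n -> cnt b j n <= cnt a j n.
Proof.
split=> [e j /bal_suffix|suf]; first by rewrite e addn0.
have := lastuP n; case: (lastu n) => [k [[kn _ _ _] e]|[_ e]].
  by have := suf k.+1 kn; lia.
by have := suf 0 isT; lia.
Qed.

End Brackets.

(** * The operator [f_i] on words *)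

Section FWord.
Variables (i : nat) (w : seq nat).

Definition is_i l := nth 0 w l == i.
Definition is_i1 l := nth 0 w l == i.+1.

Lemma is_i_i1 l : is_i l -> ~~ is_i1 l.
Proof. by rewrite /is_i /is_i1 => /eqP ->; rewrite neq_ltn ltnSn. Qed.

Lemma f_wordP w' :
  f_word i w = Some w' <->
  exists2 k, unbr_last is_i is_i1 (size w) k & w' = set_nth 0 w k i.+1.
Proof.
(* The counter of [unbr_i] after reading [u]; it lets the left-to-right scan be extended by a letter
   on the right, as in the recursion of [lastu]. *)
pose stk c (u : seq nat) := foldl
  (fun c x => if x == i.+1 then c.+1 else if x == i then c.-1 else c) c u.
have unbr_rcons c k u x : unbr_i i c k (rcons u x) =
    unbr_i i c k u ++ if (x == i) && (stk c u == 0) then [:: k + size u] else [::].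
  elim: u c k => [|y u IH] c k /=.
    rewrite addn0; case: (x =P i.+1) => [->|_].
      by rewrite (gtn_eqF (ltnSn i)).
    by case: (x == i) => //; case: c.
  rewrite -addSnnS; case: ifP => // _; case: ifP => // _.
  by case: c => //= ; rewrite IH.
have step n : n <= size w ->
    ohead (rev (unbr_i i 0 0 (take n w))) = lastu is_i is_i1 n
    /\ stk 0 (take n w) = bal is_i is_i1 n.
  elim: n => [|n IH] nw; first by rewrite take0.
  have [e1 e2] := IH (ltnW nw).
  rewrite (take_nth 0 nw) unbr_rcons rev_cat /stk foldl_rcons.
  rewrite -/(stk 0 (take n w)) e2 /= add0n size_takel 1?ltnW //.
  by split=> //; rewrite -/(is_i n); case: ifP => // _.
have [e _] := step _ (leqnn _); rewrite take_size in e.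
rewrite /f_word; split.
  case: (rev _) e => //= k s /esym /lastu_unbr uk [<-]; exists k => //.
  exact: (uk is_i_i1).
case=> k /(lastu_unbr is_i_i1) uk ->; rewrite uk in e.
by case: (rev _) e => //= ? ? [->].
Qed.

End FWord.

(** * Standardization *)

Section Standardization.
Implicit Types (w t : seq nat) (i j k l x y : nat).

(* [std_word w] ranks the indices of [w] for the strict total order [word_lt]. *)
Definition word_lt w j k : bool :=
  (nth 0 w j < nth 0 w k) || ((nth 0 w j == nth 0 w k) && (j < k)).

Lemma word_lt_irr w k : word_lt w k k = false.
Proof. by rewrite /word_lt !ltnn andbF. Qed.

Lemma size_std_word w : size (std_word w) = size w.
Proof. by rewrite size_map size_iota. Qed.

Lemma nth_std_word w k : k < size w ->
  nth 0 (std_word w) k = (cnt (fun j => word_lt w j k) 0 (size w)).+1.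
Proof.
move=> kw; rewrite (nth_map 0) ?size_iota // nth_iota // add0n addn1.
rewrite -{2}(take_size w) !count_cnt ?(ltnW kw) //=; congr _.+1.
rewrite cntU => [|l _]; last by lia.
congr (_ + _); rewrite (@cnt_cat _ k 0 (size w)) ?(ltnW kw) //.
rewrite [cnt _ k _]cnt0 ?addn0 => [|l]; last by lia.
by apply: eq_cnt => l /andP [_ ->]; rewrite andbT.
Qed.

Lemma cnt_pred1 k n : k < n -> cnt (pred1 k) 0 n = 1.
Proof.
move=> kn; rewrite (@cnt_cat _ k) ?(ltnW kn) // (@cntSl _ k) //= eqxx.
by rewrite !cnt0 // => l /=; lia.
Qed.

Lemma std_word_lt w j k : j < size w -> k < size w ->
  (nth 0 (std_word w) j < nth 0 (std_word w) k) = word_lt w j k.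
Proof.
have mono u v : u < size w -> v < size w -> word_lt w u v ->
    nth 0 (std_word w) u < nth 0 (std_word w) v.
  move=> uw vw uv; rewrite !nth_std_word // ltnS.
  rewrite -addn1 -(cnt_pred1 uw) -cntU => [|l _ /=]; last first.
    by apply: contraTneq => ->; rewrite word_lt_irr.
  apply: sub_cnt => l _ /orP [lu|/eqP -> //].
  by move: lu uv; rewrite /word_lt; lia.
move=> jw kw; apply/idP/idP; last exact: mono.
apply: contraTT => njk; rewrite -leqNgt leq_eqVlt.
have [-> //|jk] := eqVneq j k; first by rewrite eqxx.
by rewrite mono ?orbT //; move: njk jk; rewrite /word_lt; lia.
Qed.

Lemma perm_std_word w : perm_eq (std_word w) (iota 1 (size w)).
Proof.
have us : uniq (std_word w).
  apply/(uniqP 0) => j k; rewrite !inE size_std_word => jw kw e.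
  move: (std_word_lt jw kw) (std_word_lt kw jw); rewrite e ltnn /word_lt.
  lia.
have sub : {subset std_word w <= iota 1 (size w)}.
  move=> x /(nthP 0) [k]; rewrite size_std_word => kw <-.
  rewrite mem_iota nth_std_word //= add1n ltnS.
  have := cnt_le (fun j => word_lt w j k || (j == k)) 0 (size w).
  rewrite cntU ?(cnt_pred1 kw) => [|l _]; first by lia.
  by apply: contraTneq => ->; rewrite word_lt_irr.
apply: uniq_perm => //; first exact: iota_uniq.
by have [|_ ?] := uniq_min_size us sub; rewrite ?size_iota ?size_std_word.
Qed.

Lemma cnt_perm_iota t n x y : perm_eq t (iota 1 n) -> 0 < x -> x <= y ->
  y <= n.+1 -> cnt (fun l => x <= nth 0 t l < y) 0 n = y - x.
Proof.
move=> pt x0 xy yn; have st : size t = n by rewrite (perm_size pt) size_iota.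
rewrite -{1}st -(@count_cnt (fun z => x <= z < y)) ?st // -st take_size.
rewrite (permP pt) (_ : n = (x - 1) + ((y - x) + (n.+1 - y))); last by lia.
rewrite !iotaD !count_cat.
have cF s : (forall z, z \in s -> ~~ (x <= z < y)) ->
    count (fun z => x <= z < y) s = 0.
  by move=> h; apply/eqP; rewrite -leqn0 leqNgt -has_count -all_predC; apply/allP.
rewrite cF => [|z]; last by rewrite mem_iota; lia.
rewrite [X in _ + (_ + X)]cF => [|z]; last by rewrite mem_iota; lia.
rewrite addn0 add0n (_ : 1 + _ = x); last by lia.
rewrite -[RHS](size_iota x); apply/eqP; rewrite -all_count.
by apply/allP => z; rewrite mem_iota; lia.
Qed.

Lemma perm_iota_range t n l : perm_eq t (iota 1 n) -> l < n ->
  0 < nth 0 t l <= n.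
Proof.
move=> pt ln; have st : size t = n by rewrite (perm_size pt) size_iota.
have : nth 0 t l \in iota 1 n by rewrite -(perm_mem pt) mem_nth // st.
by rewrite mem_iota; lia.
Qed.

Lemma perm_iota_inj t n j l : perm_eq t (iota 1 n) -> j < n -> l < n ->
  nth 0 t j = nth 0 t l -> j = l.
Proof.
move=> pt jn ln; have st : size t = n by rewrite (perm_size pt) size_iota.
have ut : uniq t by rewrite (perm_uniq pt) iota_uniq.
by move/eqP; rewrite nth_uniq ?st // => /eqP.
Qed.

(** A permutation is determined by the relative order of its entries: each entry is one more than
    the number of smaller ones. *)
Lemma std_word_unique w t : perm_eq t (iota 1 (size w)) ->
  (forall j k, j < size w -> k < size w ->
     (nth 0 t j < nth 0 t k) = word_lt w j k) -> std_word w = t.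
Proof.
move=> pt tw; have st : size t = size w by rewrite (perm_size pt) size_iota.
apply: (@eq_from_nth _ 0) => [|k]; rewrite size_std_word // => kw.
have tk := perm_iota_range pt kw.
rewrite nth_std_word // -(@eq_cnt (fun l => 0 < nth 0 t l < nth 0 t k)).
  by rewrite (cnt_perm_iota pt) //; lia.
by move=> l /andP [_ lw]; rewrite -tw //; have := perm_iota_range pt lw; lia.
Qed.

(* The indices other than [k] whose rank drops when the letter [i] at index [k]
   is raised to [i+1]. *)
Definition passed w i k l : bool :=
  ((k < l) && (nth 0 w l == i)) || ((l < k) && (nth 0 w l == i.+1)).

Section RaiseLetter.
Variables (w : seq nat) (i k : nat).
Hypotheses (kw : k < size w) (wk : nth 0 w k = i).

Let w' := set_nth 0 w k i.+1.

Let sw' : size w' = size w.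
Proof. by rewrite size_set_nth; apply/maxn_idPr. Qed.

Lemma std_raise_at :
  nth 0 (std_word w') k = nth 0 (std_word w) k + cnt (passed w i k) 0 (size w).
Proof.
rewrite !nth_std_word ?sw' // addSn -cntU => [|l _]; last first.
  by rewrite /word_lt /passed wk; lia.
congr _.+1; apply: eq_cnt => l _; rewrite /word_lt /passed !nth_set_nth /=.
by rewrite eqxx wk; case: eqP => [->|]; rewrite ?wk; lia.
Qed.

Lemma std_raise_off l : l < size w -> l != k ->
  nth 0 (std_word w) l = nth 0 (std_word w') l + passed w i k l.
Proof.
move=> lw lk; rewrite !nth_std_word ?sw' // addSn; congr _.+1.
(* Index [k] is isolated because only its comparison with [l] can change. *)
have D P : cnt P 0 (size w) = cnt P 0 k + (P k + cnt P k.+1 (size w)).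
  by rewrite -cntSl // -cnt_cat // ltnW.
rewrite !D.
have E j : j != k -> word_lt w' j l = word_lt w j l.
  by move=> jk; rewrite /word_lt !nth_set_nth /= (negbTE jk) (negbTE lk).
rewrite (@eq_cnt (fun j => word_lt w' j l) (fun j => word_lt w j l) 0) => [|j ?];
  last by apply: E; lia.
rewrite (@eq_cnt (fun j => word_lt w' j l) (fun j => word_lt w j l) k.+1)
  => [|j ?]; last by apply: E; lia.
suff -> : (word_lt w k l : nat) = word_lt w' k l + passed w i k l by lia.
rewrite /word_lt /passed !nth_set_nth /= eqxx (negbTE lk) wk; lia.
Qed.

End RaiseLetter.
End Standardization.

(** * Row insertion *)

Lemma iotaS_rcons s n : iota s n.+1 = rcons (iota s n) (s + n).
Proof. by rewrite -addn1 iotaD cats1. Qed.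

Section RowInsertion.
Implicit Types (t : tableau) (r u : seq nat).

Definition bumps r x : bool := find (fun y => x < y) r < size r.

Definition row_insert r x : seq nat :=
  if bumps r x then set_nth 0 r (find (fun y => x < y) r) x else rcons r x.

Definition bumped r x : nat := nth 0 r (find (fun y => x < y) r).

Lemma rs_insert_row0 t x :
  nth [::] (rs_insert t x) 0 = row_insert (nth [::] t 0) x.
Proof. by case: t => [|r t] //=; rewrite /row_insert /bumps; case: ifP. Qed.

Lemma rs_insert_row1 t x :
  nth [::] (rs_insert t x) 1 =
  if bumps (nth [::] t 0) x
  then row_insert (nth [::] t 1) (bumped (nth [::] t 0) x)
  else nth [::] t 1.
Proof.
case: t => [|r t] //=; rewrite /bumps; case: ifP => // _ /=.
by rewrite -/(nth [::] _ 0) rs_insert_row0; case: t.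
Qed.

Lemma rs_insert_size t x : size t <= size (rs_insert t x).
Proof.
by elim: t x => [|r t IH] x //=; case: ifP => //= _; rewrite ltnS.
Qed.

(** A third row appears only when both lower rows bump; thus two rows and this bound suffice to
    follow the insertion. *)
Lemma rs_insert_size_le2 t x : size t <= 2 ->
  (size (rs_insert t x) <= 2) =
  ~~ (bumps (nth [::] t 0) x
      && bumps (nth [::] t 1) (bumped (nth [::] t 0) x)).
Proof.
case: t => [|r1 [|r2 [|]]] //= _; rewrite /bumps.
  by case: ifP.
by case: ifP => //= _; rewrite -/(bumped r1 x); case: ifP.
Qed.

Lemma row_insert_sorted r x : sorted leq r -> sorted leq (row_insert r x).
Proof.
have E z s : row_insert (z :: s) x = if x < z then x :: s else z :: row_insert s x.
  by rewrite /row_insert /bumps /=; case: (ltnP x z) => //= _; rewrite ltnS; case: ifP.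
have pth s z : z <= x -> path leq z s -> path leq z (row_insert s x).
  elim: s z => [|y s IH] z zx /=; first by rewrite zx.
  case/andP => zy ps; rewrite E; case: (ltnP x y) => xy /=.
    by rewrite zx; apply: path_le (ltnW xy) ps => ? ? ?; apply: leq_trans.
  by rewrite zy IH.
case: r => //= y s ps; rewrite E; case: (ltnP x y) => xy /=; last exact: pth.
by apply: path_le (ltnW xy) ps => ? ? ?; apply: leq_trans.
Qed.

Lemma P_tab_rcons u x : P_tab (rcons u x) = rs_insert (P_tab u) x.
Proof. by rewrite /P_tab foldl_rcons. Qed.

Lemma P_tab_row0_sorted u : sorted leq (nth [::] (P_tab u) 0).
Proof.
elim/last_ind: u => // u x IH; rewrite P_tab_rcons rs_insert_row0.
exact: row_insert_sorted.
Qed.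

End RowInsertion.

(* The letters [i..i+m] (called a's) and [i+m+1..i+2m] (called b's).  As long
   as the a's and the b's both come in increasing order, inserting an a bumps
   the first b of the bottom row, so that the top row collects the b's that have
   been bracketed so far. *)
Section DyckInsertion.
Variables (i m : nat) (t : seq nat).

Definition low x := i <= x <= i + m.
Definition high x := i + m < x <= i + 2 * m.
Let inI x := i <= x <= i + 2 * m.
Let balt := bal (fun l => low (nth 0 t l)) (fun l => high (nth 0 t l)).

Lemma low_high x : low x -> ~~ high x.
Proof. by rewrite /low /high; lia. Qed.

(** Here [p] a's and [q] b's have been inserted, and [j] of the b's bumped. Reading rows by [nth
    [::]] also covers tableaux with fewer than two rows. *)
Definition dyck_state (T : tableau) (p j q : nat) : Prop :=
  [/\ size T <= 2,
      nth [::] T 0 = iota i p ++ iota (i + m + 1 + j) (q - j),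
      nth [::] T 1 = iota (i + m + 1) j &
      [/\ p <= m.+1, j <= q & q <= m]].

Lemma find_gt_iota x s n : find (fun y => x < y) (iota s n) = minn (x.+1 - s) n.
Proof.
elim: n s => [|n IH] s /=; first by lia.
by case: ltnP => sx; rewrite ?IH; lia.
Qed.

Lemma dyck_state_low T p j q : dyck_state T p j q -> p <= m ->
  dyck_state (rs_insert T (i + p)) p.+1 (minn q j.+1) q.
Proof.
move=> [sT r0 r1 [pm jq qm]] pm'.
have f0 : find (fun y => i + p < y) (nth [::] T 0) = p.
  rewrite r0 find_cat has_find find_gt_iota size_iota find_gt_iota.
  by case: ifP; lia.
have bu : bumps (nth [::] T 0) (i + p) = (j < q).
  by rewrite /bumps f0 r0 size_cat !size_iota; lia.
have e0 : j < q -> bumped (nth [::] T 0) (i + p) = i + m + 1 + j.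
  move=> lt; rewrite /bumped f0 r0 nth_cat size_iota ltnn subnn nth_iota; lia.
have b1 : j < q -> bumps (nth [::] T 1) (bumped (nth [::] T 0) (i + p)) = false.
  by move=> lt; rewrite e0 // /bumps r1 find_gt_iota size_iota; lia.
split; last by split; lia.
- by rewrite rs_insert_size_le2 // bu; case: (ltnP j q) => // /b1 ->.
- rewrite rs_insert_row0 /row_insert bu f0 r0.
  case: (ltnP j q) => lt.
    rewrite (minn_idPr lt) iotaS_rcons cat_rcons.
    rewrite (_ : q - j = (q - j.+1).+1) /=; last by lia.
    apply: (@eq_from_nth _ 0) => [|l].
      by rewrite size_set_nth !size_cat /= !size_iota; lia.
    rewrite nth_set_nth /= !nth_cat size_iota; case: (eqVneq l p) => [->|lp] _.
      by rewrite ltnn subnn.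
    case: ltnP => // pl; rewrite (_ : l - p = (l - p.+1).+1) /=; last by lia.
    by congr nth; congr iota; lia.
  have -> : q = j by lia.
  rewrite subnn cats0 (_ : j - minn j j.+1 = 0) ?cats0; last by lia.
  by rewrite iotaS_rcons.
- rewrite rs_insert_row1 bu; case: (ltnP j q) => lt; last first.
    by rewrite r1; congr iota; lia.
  rewrite /row_insert b1 // e0 // r1 (minn_idPr lt).
  by rewrite iotaS_rcons.
Qed.

Lemma dyck_state_high T p j q : dyck_state T p j q -> q < m ->
  dyck_state (rs_insert T (i + m + 1 + q)) p j q.+1.
Proof.
move=> [sT r0 r1 [pm jq qm]] qm'.
have bu : bumps (nth [::] T 0) (i + m + 1 + q) = false.
  rewrite /bumps -has_find r0 has_cat !has_find !find_gt_iota !size_iota.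
  by lia.
split; last by split; lia.
- by rewrite rs_insert_size_le2 // bu.
- rewrite rs_insert_row0 /row_insert bu r0 rcons_cat; congr (_ ++ _).
  rewrite (_ : q.+1 - j = (q - j).+1); last by lia.
  by rewrite iotaS_rcons; congr rcons; lia.
- by rewrite rs_insert_row1 bu.
Qed.

(** One insertion is undone: the last letter was an a or a b that joined its run. The truncated
    predecessor in [(q - j').-1] covers both an a that bumped a b and one that found none to
    bump. *)
Lemma dyck_state_inv T x p j q : sorted leq (nth [::] T 0) ->
  dyck_state (rs_insert T x) p j q ->
  (exists j', [/\ dyck_state T p.-1 j' q, x = i + p.-1, 0 < p
                & q - j = (q - j').-1])
  \/ [/\ dyck_state T p j q.-1, x = i + m + q & j < q].
Proof.
move=> so [sT r0 r1 [pm jq qm]].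
have sT' := leq_trans (rs_insert_size T x) sT.
move: sT; rewrite rs_insert_size_le2 // => nb.
move: r0 r1; rewrite rs_insert_row0 rs_insert_row1 {1}/row_insert.
case: ifP nb => [bu /= nb r0|_ _ r0 r1]; last first.
  move: r0; case: (ltnP j q) => jq'.
    rewrite (_ : q - j = (q.-1 - j).+1); last by lia.
    rewrite iotaS_rcons -rcons_cat => /rcons_inj [r0 ->].
    by right; split => //; [split => //; split; lia | lia].
  rewrite (_ : q - j = 0) ?cats0; last by lia.
  case: p pm => [|p] pm; first by case: (nth [::] T 0).
  rewrite iotaS_rcons => /rcons_inj [r0 ->].
  left; exists j; split=> //; try lia.
  by split=> //; [rewrite r0 (_ : q - j = 0) ?cats0 //; lia | split; lia].
rewrite /row_insert (negbTE nb).
case: j jq r0 => [|j] jq r0; first by case: (nth [::] T 1).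
rewrite iotaS_rcons => /rcons_inj [r1 ebu].
move: bu r0 ebu; rewrite /bumps /bumped.
set k := find _ _; set r := nth [::] T 0 => kr r0 ebu.
have xb : x < nth 0 r k by apply: (@nth_find _ 0 (fun y => x < y)); rewrite has_find.
have sr : size r = p + (q - j.+1).
  have := congr1 size r0; rewrite size_set_nth size_cat !size_iota => <-.
  by apply/esym/maxn_idPr.
have nr l : l != k -> nth 0 r l =
    nth 0 (iota i p ++ iota (i + m + 1 + j.+1) (q - j.+1)) l.
  by move=> lk; rewrite -r0 nth_set_nth /= (negbTE lk).
have xe : x = nth 0 (iota i p ++ iota (i + m + 1 + j.+1) (q - j.+1)) k.
  by rewrite -r0 nth_set_nth /= eqxx.
(* Among the b's of the new row, [x] would exceed the letter it bumped. *)
have kp : k < p.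
  rewrite ltnNge; apply/negP => pk; move: xb; rewrite xe nth_cat size_iota.
  by rewrite (leq_gtF pk) nth_iota ?ebu; lia.
(* Otherwise an a would follow the bumped b in the old row, which is sorted. *)
have pk : p = k.+1.
  apply/eqP; rewrite eqn_leq kp andbT leqNgt; apply/negP => kp'.
  have k1 : k.+1 < size r by lia.
  have := sortedP 0 so k k1; rewrite -/r ebu nr; last by lia.
  rewrite nth_cat size_iota kp' nth_iota //; lia.
left; exists j; split; try lia.
  split=> //; last by split; lia.
  rewrite -/r; apply: (@eq_from_nth _ 0) => [|l lr].
    by rewrite size_cat !size_iota; lia.
  case: (eqVneq l k) => [->|lk]; rewrite ?ebu ?(nr l) // !nth_cat !size_iota.
    by rewrite pk /= ltnn subnn nth_iota; lia.
  case: ifP => [lp|pl].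
    by rewrite !nth_iota ?pk /=; try lia; case: ifP; lia.
  by rewrite (_ : l < p.-1 = false) ?nth_iota; lia.
by rewrite xe nth_cat size_iota kp nth_iota // pk.
Qed.

Lemma filter_take_nth (P : pred nat) n : n < size t ->
  [seq x <- take n.+1 t | P x] =
  if P (nth 0 t n) then rcons [seq x <- take n t | P x] (nth 0 t n)
  else [seq x <- take n t | P x].
Proof. by move=> nt; rewrite (take_nth 0 nt) filter_rcons. Qed.

Lemma inI_cases x : inI x = low x || high x.
Proof. rewrite /inI /low /high; lia. Qed.

(** The [j] bumped b's are the bracketed ones; the open ones are those left in the bottom row. *)
Lemma dyck_state_of_shuffle n p q : n <= size t ->
  [seq x <- take n t | low x] = iota i p ->
  [seq x <- take n t | high x] = iota (i + m + 1) q ->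
  exists2 j, dyck_state (P_tab [seq x <- take n t | inI x]) p j q
    & q = j + balt n.
Proof.
elim: n p q => [|n IH] p q nt.
  rewrite take0 /= => e1 e2; exists 0; move: (congr1 size e1) (congr1 size e2).
    by rewrite !size_iota => <- <-; split.
  by rewrite !size_iota.
rewrite !filter_take_nth // inI_cases /= -/balt.
have [lo|nlo] := boolP (low _) => /=.
  rewrite (negbTE (low_high lo)).
  case: p => [|p]; first by case: filter.
  rewrite iotaS_rcons => /rcons_inj [ea ex] eb.
  have [j st bn] := IH _ _ (ltnW nt) ea eb.
  exists (minn q j.+1); last by lia.
  rewrite ex P_tab_rcons; apply: dyck_state_low => //.
  by move: lo; rewrite ex /low; lia.
have [hi|nhi] := boolP (high _) => /= ea; last exact: IH (ltnW nt) ea.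
case: q => [|q]; first by case: filter.
rewrite iotaS_rcons => /rcons_inj [eb ex].
have [j st bn] := IH _ _ (ltnW nt) ea eb.
exists j; last by lia.
rewrite ex P_tab_rcons; apply: dyck_state_high => //.
by move: hi; rewrite ex /high; lia.
Qed.

Lemma shuffle_of_dyck_state n p j q : n <= size t ->
  dyck_state (P_tab [seq x <- take n t | inI x]) p j q ->
  [/\ [seq x <- take n t | low x] = iota i p,
      [seq x <- take n t | high x] = iota (i + m + 1) q &
      q = j + balt n].
Proof.
elim: n p j q => [|n IH] p j q nt.
  rewrite take0 /= => -[_ r0 r1 [? ? ?]].
  move: (congr1 size r0) (congr1 size r1); rewrite size_cat !size_iota /=.
  by move=> ? ?; have [-> -> ->] : [/\ p = 0, q = 0 & j = 0] by split; lia.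
rewrite !filter_take_nth // inI_cases /= -/balt.
have [lh|] := boolP (_ || _); last first.
  by rewrite negb_or => /andP [/negbTE -> /negbTE ->]; apply: IH; apply: ltnW.
rewrite P_tab_rcons => st0; have [_ _ _ [? ? ?]] := st0.
case: (dyck_state_inv (P_tab_row0_sorted _) st0) => [[j' [st ex p0 ej]]|[st ex jq]].
  have [-> -> e] := IH _ _ _ (ltnW nt) st; case: st => _ _ _ [? ? ?].
  have lo : low (nth 0 t n) by rewrite ex /low; lia.
  rewrite lo (negbTE (low_high lo)) ex; split=> //; last by lia.
  by rewrite -{3}(prednK p0) iotaS_rcons.
have [-> -> e] := IH _ _ _ (ltnW nt) st; case: st => _ _ _ [? ? ?].
have hi : high (nth 0 t n) by rewrite ex /high; lia.
have lo : low (nth 0 t n) = false by rewrite ex /low; lia.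
rewrite hi lo ex; split=> //; last by lia.
have {3}-> : q = q.-1.+1 by lia.
by rewrite iotaS_rcons; congr rcons; lia.
Qed.

Lemma dyck_filterP : 0 < m ->
  P_tab [seq x <- t | inI x] = [:: iota i m.+1; iota (i + m + 1) m] <->
  [/\ [seq x <- t | low x] = iota i m.+1,
      [seq x <- t | high x] = iota (i + m + 1) m & balt (size t) = 0].
Proof.
move=> m0; split=> [e|[ea eb e0]].
  have st : dyck_state (P_tab [seq x <- take (size t) t | inI x]) m.+1 m m.
    by rewrite take_size e; split => //; rewrite subnn cats0.
  have := shuffle_of_dyck_state (leqnn _) st; rewrite take_size => -[-> -> ?].
  by split=> //; lia.
have := @dyck_state_of_shuffle (size t) m.+1 m (leqnn _).
rewrite take_size => /(_ ea eb) [j]; rewrite e0 addn0 => st ej; subst j.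
case: st; rewrite subnn cats0.
(* A one-row tableau would also read as having an empty top row; [0 < m] excludes it. *)
case: P_tab => [|r0 [|r1 [|? ?]]] //= _ => [|-> -> //] e1 e2 _.
by move: m0; rewrite -(size_iota (i + m + 1) m) -e2.
Qed.

End DyckInsertion.

(** * Tableaux as words *)

Section TableauWords.
Implicit Types (T : tableau) (lam w : seq nat).

Lemma row_wordK lam T : Defs.shape T = lam -> tableau_of_word lam (row_word T) = T.
Proof.
move=> <-; rewrite /tableau_of_word /row_word /Defs.shape -map_rev.
by rewrite -/(seq.shape (rev T)) flattenK revK.
Qed.

Lemma tableau_of_wordK lam w :
  size w = sumn lam -> row_word (tableau_of_word lam w) = w.
Proof.
by move=> sw; rewrite /row_word revK reshapeKr // sumn_rev sw.
Qed.

Lemma shape_tableau_of_word lam w :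
  size w = sumn lam -> Defs.shape (tableau_of_word lam w) = lam.
Proof.
move=> sw; rewrite /Defs.shape map_rev -/(seq.shape _) reshapeKl ?revK //.
by rewrite sumn_rev sw.
Qed.

Lemma size_row_word T : size (row_word T) = sumn (Defs.shape T).
Proof. by rewrite size_flatten /seq.shape map_rev sumn_rev. Qed.

(* The index in the reading word of the first cell of row [r]. *)
Definition row_start lam r : nat := sumn (drop r.+1 lam).

Lemma row_startS lam r :
  row_start lam r = row_start lam r.+1 + nth 0 lam r.+1.
Proof.
rewrite /row_start; case: (ltnP r.+1 (size lam)) => rl.
  by rewrite (drop_nth 0 rl) /= addnC.
by rewrite nth_default // !drop_oversize // ltnW.
Qed.

Lemma row_end lam r : row_start lam r + nth 0 lam r <= sumn lam.
Proof.
rewrite -{3}(cat_take_drop r lam) sumn_cat.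
rewrite /row_start; case: (ltnP r (size lam)) => rl.
  by rewrite (drop_nth 0 rl) /=; lia.
by rewrite nth_default // drop_oversize //; lia.
Qed.

Lemma nth_row_word T r j : j < size (nth [::] T r) ->
  nth 0 (nth [::] T r) j
  = nth 0 (row_word T) (row_start (Defs.shape T) r + j).
Proof.
rewrite /row_word; elim: T r => [|s T IH] [|r] //=.
  move=> _; rewrite rev_cons flatten_rcons nth_cat /row_start /= drop0.
  by rewrite -size_row_word ltnNge leq_addr /= addKn.
move=> jr; rewrite rev_cons flatten_rcons nth_cat IH // /row_start /=.
rewrite -/(row_word T) size_row_word ifT //.
apply: leq_trans (row_end _ r); rewrite ltn_add2l.
case: (ltnP r (size T)) => rT; first by rewrite (nth_map [::]).
by move: jr; rewrite nth_default.
Qed.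

(** The tableau conditions moved to indices of the reading word, where a word and its
    standardization can be compared directly. *)
Definition word_tableau lam w : Prop :=
  (forall r j, j.+1 < nth 0 lam r ->
     nth 0 w (row_start lam r + j) <= nth 0 w (row_start lam r + j.+1)) /\
  (forall r j, j < nth 0 lam r.+1 ->
     nth 0 w (row_start lam r + j) < nth 0 w (row_start lam r.+1 + j)).

Lemma partition_nth_ge lam r : is_partition lam -> nth 0 lam r.+1 <= nth 0 lam r.
Proof.
case/andP => /(sortedP 0) so _.
case: (ltnP r.+1 (size lam)) => rl; first exact: so.
by rewrite nth_default.
Qed.

Lemma is_tableauP lam T : is_partition lam -> Defs.shape T = lam ->
  is_tableau lam T <-> word_tableau lam (row_word T).
Proof.
move=> pl eT; have sz r : size (nth [::] T r) = nth 0 lam r.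
  rewrite -eT; case: (ltnP r (size T)) => rT; first by rewrite (nth_map [::]).
  by rewrite !nth_default // size_map.
split.
  case=> _ [so co]; split=> r j jr.
    rewrite -eT -!nth_row_word ?sz ?(ltnW jr) //.
    by have /(sortedP 0) := so r; apply; rewrite sz.
  rewrite -eT -!nth_row_word ?sz //; first by apply: co; rewrite sz.
  exact: leq_trans jr (partition_nth_ge _ pl).
case=> so co; split=> //; split=> [r|r j].
  apply/(sortedP 0) => j; rewrite sz => jr; rewrite !nth_row_word ?sz ?(ltnW jr) //.
  by rewrite eT; apply: so.
rewrite sz => jr; rewrite !nth_row_word ?sz // ?eT; first exact: co.
exact: leq_trans jr (partition_nth_ge _ pl).
Qed.

(** Standardization breaks ties by reading order, which goes rightwards in a row and downwards in a
    column: weak row and strict column comparisons are both preserved. *)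
Lemma word_tableau_std lam w : is_partition lam -> size w = sumn lam ->
  word_tableau lam (std_word w) <-> word_tableau lam w.
Proof.
move=> pl sw.
have lt r j : j < nth 0 lam r -> row_start lam r + j < size w.
  by move=> jr; rewrite sw; apply: leq_trans (row_end lam r); rewrite ltn_add2l.
have lt' r j : j < nth 0 lam r.+1 -> row_start lam r + j < size w.
  by move=> jr; apply: lt; apply: leq_trans jr (partition_nth_ge _ pl).
have rowE r j : j.+1 < nth 0 lam r ->
    (nth 0 (std_word w) (row_start lam r + j)
       <= nth 0 (std_word w) (row_start lam r + j.+1))
    = (nth 0 w (row_start lam r + j) <= nth 0 w (row_start lam r + j.+1)).
  move=> jr; rewrite leqNgt std_word_lt; [|exact: lt|exact/lt/ltnW].
  by rewrite /word_lt; lia.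
have colE r j : j < nth 0 lam r.+1 ->
    (nth 0 (std_word w) (row_start lam r + j)
       < nth 0 (std_word w) (row_start lam r.+1 + j))
    = (nth 0 w (row_start lam r + j) < nth 0 w (row_start lam r.+1 + j)).
  move=> jr; rewrite std_word_lt; [|exact: lt'|exact: lt].
  by rewrite /word_lt (row_startS lam r); lia.
split=> -[so co]; split=> r j jr.
- by rewrite -rowE //; apply: so.
- by rewrite -colE //; apply: co.
- by rewrite rowE //; apply: so.
- by rewrite colE //; apply: co.
Qed.

(* If the unbracketed [i] had an [i+1] just above it, then above every [i] to its
   left in the same row there would be an [i+1] too: between the first of those
   [i+1] and our [i] there are more [i+1] than [i], so our [i] is bracketed. *)
Lemma word_tableau_raise lam w i k :
  is_partition lam -> size w = sumn lam -> word_tableau lam w ->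
  unbr_last (is_i i w) (is_i1 i w) (size w) k ->
  word_tableau lam (set_nth 0 w k i.+1).
Proof.
move=> pl sw [so co] [kw /eqP wk U1 U2].
have nk x : nth 0 (set_nth 0 w k i.+1) x = if x == k then i.+1 else nth 0 w x.
  by rewrite nth_set_nth.
have inc r j j' : j <= j' -> j' < nth 0 lam r ->
    nth 0 w (row_start lam r + j) <= nth 0 w (row_start lam r + j').
  move=> /subnK <-; elim: (j' - j) => [|d IH] //; rewrite addSn => dr.
  by apply: leq_trans (so _ _ dr); apply: IH; apply: ltnW.
split=> r j jr; rewrite !nk.
  have := so r j jr; case: (eqVneq (_ + j) k) => [ek|_]; last first.
    by case: eqP => [->|] //; rewrite wk; lia.
  rewrite (_ : _ == k = false); last by rewrite -ek; lia.
  rewrite ek wk leq_eqVlt => /orP [/eqP e|//].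
  have kr : k.+1 < size w.
    by rewrite sw -ek; apply: leq_trans (row_end lam r); lia.
  (* An [i] immediately to the right of [k] would be unmatched. *)
  have := U2 k.+2 ltac:(lia); rewrite !(@cntSr _ k.+1 k.+1) // !cntxx /is_i /is_i1.
  by rewrite (_ : k.+1 = row_start lam r + j.+1) -?e; lia.
have := co r j jr; case: (eqVneq (row_start lam r + j) k) => [ek|_]; last first.
  by case: eqP => [->|] //; rewrite wk; lia.
rewrite (_ : _ == k = false); last by rewrite -ek (row_startS lam r); lia.
rewrite ek wk leq_eqVlt => /orP [/eqP e|//]; exfalso.
have ej : exists x, (x <= j) && (nth 0 w (row_start lam r + x) == i).
  by exists j; rewrite leqnn ek wk eqxx.
case: (ex_minnP ej) => j0 /andP [j0j /eqP wj0] minj0.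
set s1 := row_start lam r.+1 in e *.
have jr' : j < nth 0 lam r by apply: leq_trans jr (partition_nth_ge _ pl).
have es : row_start lam r = s1 + nth 0 lam r.+1 by rewrite row_startS.
set L := nth 0 lam r.+1 in jr es.
have up x : j0 <= x <= j -> nth 0 w (s1 + x) = i.+1.
  move=> /andP [jx xj]; have := inc r.+1 x j xj jr; rewrite -/s1 -e.
  have := co r x (leq_ltn_trans xj jr); rewrite -/s1.
  by have := inc r j0 x jx (leq_ltn_trans xj jr'); rewrite wj0; lia.
have := U1 (s1 + j0) ltac:(lia); apply/negP; rewrite -ltnNge.
have B : j.+1 - j0 <= cnt (is_i1 i w) (s1 + j0) k.
  apply: leq_trans (_ : cnt (is_i1 i w) (s1 + j0) (s1 + j.+1) <= _); last first.
    by apply: cnt_shrink; lia.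
  rewrite cnt_all ?subnDl // => l ?; rewrite /is_i1.
  by have := up (l - s1) ltac:(lia); rewrite subnKC ?[_ == _]eqxx; lia.
apply: leq_trans B.
(* Between the two cells of column [j0] there is no [i]: the rest of the upper row exceeds [i], and
   [j0] is minimal in the lower row. *)
rewrite (@cnt_cat _ (s1 + L + j0)); try lia.
rewrite cnt0 => [|l /andP [l1 l2]].
  by have := cnt_le (is_i i w) (s1 + L + j0) k; lia.
rewrite /is_i; case: (ltnP l (s1 + L)) => lL.
  have := inc r.+1 j0 (l - s1) ltac:(lia) ltac:(rewrite -/L; lia).
  by rewrite -/s1 up ?j0j ?leqnn // subnKC; lia.
apply/negP => wl; have := minj0 (l - (s1 + L)).
by rewrite es subnKC // wl andbT; lia.
Qed.

End TableauWords.

(** * Dyck pattern intervals *)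

Lemma sorted_filter_lt (P : pred nat) (t : seq nat) j k :
  sorted ltn [seq x <- t | P x] -> j < k -> k < size t ->
  P (nth 0 t j) -> P (nth 0 t k) -> nth 0 t j < nth 0 t k.
Proof.
move=> so jk kt pj pk.
have sub : subseq [:: nth 0 t j; nth 0 t k] t.
  rewrite -[X in subseq _ X](cat_take_drop k) -cat1s.
  apply: cat_subseq; rewrite sub1seq; last by rewrite (drop_nth 0 kt) mem_head.
  by rewrite -(nth_take 0 jk) mem_nth // size_takel // ltnW.
have /(subseq_sorted ltn_trans) : subseq [:: nth 0 t j; nth 0 t k] [seq x <- t | P x].
  by rewrite subseq_filter /= pj pk.
by move=> /(_ so) /= /andP [].
Qed.

Lemma lt_sorted_filter (P : pred nat) (t : seq nat) :
  (forall j k, j < k -> k < size t -> P (nth 0 t j) -> P (nth 0 t k) ->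
     nth 0 t j < nth 0 t k) -> sorted ltn [seq x <- t | P x].
Proof.
move=> mo; rewrite -(mkseq_nth 0 t) filter_map.
apply: (@homo_sorted_in _ _ (fun l => (l < size t) && P (nth 0 t l)) _ ltn).
- by move=> j k /andP [_ pj] /andP [kt pk] jk; apply: mo.
- by rewrite all_filter; apply/allP => l; rewrite mem_iota => /= ->; apply/implyP.
- exact: (sorted_filter ltn_trans _ (iota_ltn_sorted 0 (size t))).
Qed.

Lemma filter_perm_iota (P : pred nat) t n x s :
  perm_eq t (iota 1 n) -> sorted ltn [seq y <- t | P y] ->
  (forall y, P y = (x <= y < x + s)) -> 0 < x -> x + s <= n.+1 ->
  [seq y <- t | P y] = iota x s.
Proof.
move=> pt so PE x0 xs; apply: (irr_sorted_eq ltn_trans ltnn so) => [|y].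
  exact: iota_ltn_sorted.
rewrite mem_filter (perm_mem pt) !mem_iota PE; lia.
Qed.

(** Since [t] is a permutation, its letters in either half form the required word as soon as they
    increase. *)
Lemma dyck_intervalP t n i m : perm_eq t (iota 1 n) ->
  dyck_interval t (i, m) <->
  [/\ [/\ 0 < i, 0 < m & i + 2 * m <= n],
      forall j k, j < k -> k < n -> low i m (nth 0 t j) -> low i m (nth 0 t k) ->
        nth 0 t j < nth 0 t k,
      forall j k, j < k -> k < n -> high i m (nth 0 t j) -> high i m (nth 0 t k) ->
        nth 0 t j < nth 0 t k &
      bal (fun l => low i m (nth 0 t l)) (fun l => high i m (nth 0 t l)) n = 0].
Proof.
move=> pt; have st : size t = n by rewrite (perm_size pt) size_iota.
rewrite /dyck_interval st; split.
  case=> i0 m0 imn /(dyck_filterP _ _ m0) [ea eb]; rewrite st => e0; split=> //.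
    move=> j k jk kn; apply: sorted_filter_lt; rewrite ?st // ea.
    exact: iota_ltn_sorted.
  move=> j k jk kn; apply: sorted_filter_lt; rewrite ?st // eb.
  exact: iota_ltn_sorted.
case=> [[i0 m0 imn] mo_lo mo_hi e0]; split=> //; apply/(dyck_filterP _ _ m0).
split; last by rewrite st.
  apply: (filter_perm_iota pt); rewrite /low; try lia.
  by apply: lt_sorted_filter; rewrite st.
apply: (filter_perm_iota pt); rewrite /high; try lia.
by apply: lt_sorted_filter; rewrite st.
Qed.

Lemma eq_unbr_last a b a' b' n k : (forall l, l < n -> a l = a' l) ->
  (forall l, l < n -> b l = b' l) -> unbr_last a b n k -> unbr_last a' b' n k.
Proof.
move=> ea eb [kn ak U1 U2].
have E c c' j l : (forall l, l < n -> c l = c' l) -> l <= n -> cnt c' j l = cnt c j l.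
  by move=> ec ln; apply: eq_cnt => x /andP [_ xl]; rewrite ec //; apply: leq_trans ln.
split=> // [|j jk|j /andP [kj jn]]; first by rewrite -ea.
  by rewrite !(E _ _ _ _ ea, E _ _ _ _ eb) ?(ltnW kn) //; apply: U1.
by rewrite (E _ _ _ _ ea) ?(E _ _ _ _ eb) //; apply: U2; rewrite kj.
Qed.

Lemma cnt_passed w i k n : k < n ->
  cnt (passed w i k) 0 n = cnt (is_i1 i w) 0 k + cnt (is_i i w) k.+1 n.
Proof.
move=> kn; rewrite (@cnt_cat _ k) ?(ltnW kn) // (@cntSl _ k) //.
rewrite {2}/passed !ltnn /= add0n; congr (_ + _).
  by apply: eq_cnt => l /andP [_ lk]; rewrite /passed lk ltnNge ltnW.
by apply: eq_cnt => l /andP [kl _]; rewrite /passed kl ltnNge ltnW //= orbF.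
Qed.

(* The most degenerate word with the given Dyck interval: the only repeated
   letters are the [i]'s and the [i+1]'s that stand for the two halves of it. *)
Definition collapse i m x : nat :=
  if low i m x then i else if high i m x then i.+1 else x.

Lemma collapse_i i m x : (collapse i m x == i) = low i m x.
Proof. by rewrite /collapse /low /high; do ![case: ifP]; lia. Qed.

Lemma collapse_i1 i m x : 0 < m -> (collapse i m x == i.+1) = high i m x.
Proof. by rewrite /collapse /low /high; do ![case: ifP]; lia. Qed.

(** The relation between intervals and targets of edges on which both bijections rest. *)
Definition dyck_step t (I : nat * nat) t' : Prop :=
  exists2 w', f_word I.1 (map (collapse I.1 I.2) t) = Some w' & t' = std_word w'.

(** * From a Dyck pattern interval to the raised letter *)

Section DyckStep.
Variables (t : seq nat) (n i m : nat).
Hypotheses (pt : perm_eq t (iota 1 n)) (dy : dyck_interval t (i, m)).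

Let st : size t = n. Proof. by rewrite (perm_size pt) size_iota. Qed.
Let w := map (collapse i m) t.
Let sw : size w = n. Proof. by rewrite size_map. Qed.
Let nw l : l < n -> nth 0 w l = collapse i m (nth 0 t l).
Proof. by move=> ln; rewrite (nth_map 0) // st. Qed.

(** Only letters that already increase from left to right are merged, so breaking ties by index
    restores their order. *)
Lemma std_collapse : std_word w = t.
Proof.
have [[i0 m0 imn] mo_lo mo_hi _] := (dyck_intervalP i m pt).1 dy.
apply: std_word_unique; rewrite sw // => j k jn kn.
rewrite /word_lt !nw //.
have [->|jk] := eqVneq j k; first by rewrite !ltnn andbF.
have tjk : nth 0 t j <> nth 0 t k.
  by move/(perm_iota_inj pt jn kn); apply/eqP.
move: (mo_lo j k) (mo_lo k j) (mo_hi j k) (mo_hi k j).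
rewrite jn kn /collapse /low /high.
move: (nth 0 t j) (nth 0 t k) tjk => x y xy.
case: (ltngtP j k) jk => // jk _.
  move=> /(_ isT isT) h1 _ /(_ isT isT) h2 _.
  by do ![case: ifP]; lia.
move=> _ /(_ isT isT) h1 _ /(_ isT isT) h2.
by do ![case: ifP]; lia.
Qed.

(** There are [m + 1] closing brackets and [m] openings, all matched, so one closing bracket is left
    over. On either side of it the two kinds are equally many. *)
Lemma dyck_unbr : exists k,
  [/\ unbr_last (is_i i w) (is_i1 i w) n k,
      nth 0 t k = i + cnt (passed w i k) 0 k &
      cnt (passed w i k) 0 n = m].
Proof.
have [[i0 m0 imn] mo_lo mo_hi] := (dyck_intervalP i m pt).1 dy.
set A := (fun l => low i m (nth 0 t l)); set B := fun l => high i m _.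
have AB l : A l -> ~~ B l by apply: low_high.
move=> /(bal_eq0 AB) suf.
have cA : cnt A 0 n = m.+1.
  rewrite -(@eq_cnt (fun l => i <= nth 0 t l < i + m.+1)).
    by rewrite (cnt_perm_iota pt); lia.
  by move=> l _; rewrite /A /low; lia.
have cB : cnt B 0 n = m.
  rewrite -(@eq_cnt (fun l => i + m.+1 <= nth 0 t l < i + (2 * m).+1)).
    by rewrite (cnt_perm_iota pt); lia.
  by move=> l _; rewrite /B /high; lia.
have [k uk] : exists k, unbr_last A B n k.
  case e: (lastu A B n) => [k|]; first by exists k; apply/(lastu_unbr AB).
  by have := lastuP AB n; rewrite e => -[_]; lia.
have eA l : l < n -> A l = is_i i w l.
  by move=> ln; rewrite /is_i nw // collapse_i.
have eB l : l < n -> B l = is_i1 i w l.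
  by move=> ln; rewrite /is_i1 nw // collapse_i1.
exists k; have uk' := eq_unbr_last eA eB uk.
case: uk => kn Ak /(_ 0 isT) U1 /(_ n); rewrite kn leqnn => /(_ isT) U2.
have sk := suf k.+1 kn.
have [dA dB] : cnt A 0 n = cnt A 0 k + (A k + cnt A k.+1 n) /\
               cnt B 0 n = cnt B 0 k + (B k + cnt B k.+1 n).
  by rewrite -!cntSl // -!cnt_cat // ltnW.
rewrite Ak (negbTE (AB _ Ak)) in dA dB.
have pB : cnt (passed w i k) 0 k = cnt B 0 k.
  apply: eq_cnt => l /andP [_ lk]; rewrite /passed lk ltnNge ltnW //=.
  by rewrite eB //; apply: ltn_trans kn.
(* The lower half increases from left to right, so its values below [nth 0 t k] are exactly those
   left of [k]. *)
have lk : nth 0 t k - i = cnt A 0 k.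
  have kt : i <= nth 0 t k <= n by move: Ak; rewrite /A /low; lia.
  rewrite -(cnt_perm_iota pt i0 (y := nth 0 t k)); try lia.
  rewrite (@cnt_cat _ k 0 n) ?(ltnW kn) // [X in _ + X]cnt0 ?addn0.
    apply: eq_cnt => l /andP [_ lk]; have := mo_lo l k lk kn.
    by move: Ak; rewrite /A /low; lia.
  move=> l /andP [kl ln]; have := mo_lo k l; move: Ak; rewrite /A /low.
  by case: (ltngtP k l) kl => // [_ _|<- _]; lia.
split=> //.
  by rewrite pB; move: Ak; rewrite /A /low; lia.
rewrite cnt_passed // -(@eq_cnt B) => [|l /andP [_ ?]]; last first.
  by apply: eB; apply: ltn_trans kn.
by rewrite -(@eq_cnt A (is_i i w)) => [|l /andP [_ ln]]; [lia | exact: eA].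
Qed.

Lemma dyck_step_shift t' : dyck_step t (i, m) t' -> exists k (M : pred nat),
  [/\ k < n, nth 0 t k = i + cnt M 0 k, nth 0 t' k = nth 0 t k + m &
      forall l, l < n -> l != k -> nth 0 t l = nth 0 t' l + M l].
Proof.
case=> w' /= /f_wordP [k']; rewrite -/w sw => uk' -> ->.
have [k [uk tk cm]] := dyck_unbr.
have ek := unbr_last_inj (@is_i_i1 i w) uk uk'; subst k'.
exists k, (passed w i k); case: uk => kn /eqP wk _ _; split=> //.
  by rewrite (std_raise_at _ wk) ?sw // std_collapse cm.
by move=> l ln lk; rewrite -std_raise_off ?sw // std_collapse.
Qed.

End DyckStep.

(** The index [k] is the only one whose entry grows, [m] is its growth, and the entries that drop
    left of [k] give the offset of [nth 0 t k] from [i]. *)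
Lemma dyck_step_inj t n t' I1 I2 : perm_eq t (iota 1 n) ->
  dyck_interval t I1 -> dyck_interval t I2 ->
  dyck_step t I1 t' -> dyck_step t I2 t' -> I1 = I2.
Proof.
case: I1 I2 => [i1 m1] [i2 m2] pt d1 d2.
have [[_ m1p _] _ _ _] := (dyck_intervalP i1 m1 pt).1 d1.
have [[_ m2p _] _ _ _] := (dyck_intervalP i2 m2 pt).1 d2.
case/(dyck_step_shift pt d1) => k1 [M1 [k1n tk1 tk1' tM1]].
case/(dyck_step_shift pt d2) => k2 [M2 [k2n tk2 tk2' tM2]].
have ek : k1 = k2.
  by apply/eqP; apply: contraT => ne; have := tM2 _ k1n ne; lia.
subst k2; have em : m1 = m2 by lia.
have eM : cnt M1 0 k1 = cnt M2 0 k1.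
  apply: eq_cnt => l /andP [_ lk]; have ln := ltn_trans lk k1n.
  have := tM1 l ln ltac:(lia); have := tM2 l ln ltac:(lia).
  by case: (M1 l) (M2 l) => [] []; lia.
by congr (_, _) => //; lia.
Qed.

(** * Discarding the first, or keeping only the first, marked indices *)

Section Trimming.
Variable a : pred nat.

Lemma cnt_drop_first e n :
  cnt (fun l => a l && (e <= cnt a 0 l)) 0 n = cnt a 0 n - e.
Proof.
elim: n => [|n IH]; first by rewrite !cntxx.
rewrite !cntSr // IH; case: (a n) => /=; lia.
Qed.

Lemma cnt_keep_first f n :
  cnt (fun l => a l && (cnt a 0 l < f)) 0 n = minn (cnt a 0 n) f.
Proof.
elim: n => [|n IH]; first by rewrite !cntxx; lia.
rewrite !cntSr // IH; case: (a n) => /=; lia.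
Qed.

End Trimming.

(** * From a raised letter to a Dyck pattern interval *)

Section StdValues.
Variables (w : seq nat) (i : nat).
Let n := size w.
Let t := std_word w.
Let a := is_i i w.
Let b := is_i1 i w.
Let alpha := cnt (fun l => nth 0 w l < i) 0 n.

Let cnt_lt (c : pred nat) l : l <= n ->
  cnt (fun j => c j && (j < l)) 0 n = cnt c 0 l.
Proof.
move=> ln; rewrite (@cnt_cat _ l) // [X in _ + X]cnt0 ?addn0 => [|j]; last by lia.
by apply: eq_cnt => j /andP [_ ->]; rewrite andbT.
Qed.

Lemma std_lt_i l : l < n -> nth 0 w l < i -> nth 0 t l <= alpha.
Proof.
move=> ln wl; rewrite nth_std_word // -addn1 -(cnt_pred1 ln) -cntU => [|j _].
  by apply: sub_cnt => j _ /orP [|/eqP -> //]; rewrite /word_lt; lia.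
by apply: contraTneq => ->; rewrite word_lt_irr.
Qed.

Lemma std_eq_i l : l < n -> a l -> nth 0 t l = (alpha + cnt a 0 l).+1.
Proof.
move=> ln /eqP wl; rewrite nth_std_word // -(cnt_lt a (ltnW ln)) -cntU => [|j _].
  by congr _.+1; apply: eq_cnt => j _; rewrite /word_lt /a /is_i wl.
by rewrite /a /is_i; lia.
Qed.

Lemma std_eq_i1 l : l < n -> b l ->
  nth 0 t l = (alpha + cnt a 0 n + cnt b 0 l).+1.
Proof.
move=> ln /eqP wl; rewrite nth_std_word // -(cnt_lt b (ltnW ln)) -!cntU => [|j _|j _].
- by congr _.+1; apply: eq_cnt => j _; rewrite /word_lt /a /b /is_i /is_i1 wl; lia.
- by rewrite /a /b /is_i /is_i1; lia.
- by rewrite /a /is_i; lia.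
Qed.

Lemma std_gt_i1 l : l < n -> i.+1 < nth 0 w l ->
  alpha + cnt a 0 n + cnt b 0 n < nth 0 t l.
Proof.
move=> ln wl; rewrite nth_std_word // ltnS -!cntU => [|j _|j _].
- by apply: sub_cnt => j _; rewrite /word_lt /a /b /is_i /is_i1; lia.
- by rewrite /a /b /is_i /is_i1; lia.
- by rewrite /a /is_i; lia.
Qed.

Lemma std_cnt_le : alpha + cnt a 0 n + cnt b 0 n <= n.
Proof.
rewrite -!cntU => [|j _|j _].
- by rewrite -[leqRHS]subn0; apply: cnt_le.
- by rewrite /a /b /is_i /is_i1; lia.
- by rewrite /a /is_i; lia.
Qed.

Variable k : nat.
Hypothesis uk : unbr_last a b n k.
Let c := cnt b 0 k.
Let d := cnt a k.+1 n.
Let m := c + d.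
Let i' := nth 0 t k - c.
Hypothesis m0 : 0 < m.

(* The [i+1]'s left of [k] are bracketed with the last [c] of the [i]'s left of
   [k], and the [i]'s right of [k] with the first [d] of the [i+1]'s right of
   [k]: those letters, with the one at [k], form the Dyck interval. *)
Lemma unbr_dyck : dyck_interval t (i', m) /\ dyck_step t (i', m)
  (std_word (set_nth 0 w k i.+1)).
Proof.
case: (uk) => kn ak U1 U2; set c' := cnt a 0 k.
have abF l : a l -> ~~ b l by apply: is_i_i1.
have cc' : c <= c' by apply: (U1 0).
have tk : nth 0 t k = (alpha + c').+1 by apply: std_eq_i.
have aS : cnt a 0 k.+1 = c' + 1 by rewrite cntSr // ak.
have bS : cnt b 0 k.+1 = c by rewrite cntSr // (negbTE (abF _ ak)) addn0.
have aN : cnt a 0 n = c' + 1 + d by rewrite -aS -cnt_cat.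
have bN : cnt b 0 n = c + cnt b k.+1 n by rewrite -bS -cnt_cat.
have dd' : d <= cnt b k.+1 n by apply: U2; rewrite kn leqnn.
have tot := std_cnt_le.
have mono (x : pred nat) j l : j <= l -> l <= n -> cnt x 0 j <= cnt x 0 l.
  by move=> jl ln; apply: cnt_shrink.
(* The bound [i' + m] equals [alpha + cnt a 0 n], the value of the last [i]; only the lower bound
   cuts letters off. *)
have lowE l : l < n ->
    low i' m (nth 0 t l) = a l && (c' - c <= cnt a 0 l).
  move=> ln; rewrite /low /i' tk.
  have := mono a l.+1 n ln (leqnn _); rewrite cntSr //.
  case al: (a l) => /=; first by rewrite (std_eq_i ln al); lia.
  case bl: (b l) => /=; first by rewrite (std_eq_i1 ln bl); lia.
  have [wl|wl] := ltnP (nth 0 w l) i; first by have := std_lt_i ln wl; lia.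
  have wg : i.+1 < nth 0 w l by move: al bl; rewrite /a /b /is_i /is_i1; lia.
  by have := std_gt_i1 ln wg; lia.
(* The upper half begins with the value of the first [i+1]; only its upper bound cuts letters
   off. *)
have highE l : l < n -> high i' m (nth 0 t l) = b l && (cnt b 0 l < c + d).
  move=> ln; rewrite /high /i' tk.
  have := mono a l.+1 n ln (leqnn _); rewrite cntSr //.
  case bl: (b l) => /=; first by rewrite (std_eq_i1 ln bl); lia.
  case al: (a l) => /=; first by rewrite (std_eq_i ln al); lia.
  have [wl|wl] := ltnP (nth 0 w l) i; first by have := std_lt_i ln wl; lia.
  have wg : i.+1 < nth 0 w l by move: al bl; rewrite /a /b /is_i /is_i1; lia.
  by have := std_gt_i1 ln wg; lia.
set A := fun l => low i' m (nth 0 t l); set B := fun l => high i' m (nth 0 t l).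
have AB l : A l -> ~~ B l by apply: low_high.
have cA j : j <= n -> cnt A 0 j = cnt a 0 j - (c' - c).
  move=> jn; rewrite -cnt_drop_first; apply: eq_cnt => l /andP [_ lj].
  by apply: lowE; apply: leq_trans jn.
have cB j : j <= n -> cnt B 0 j = minn (cnt b 0 j) (c + d).
  move=> jn; rewrite -cnt_keep_first; apply: eq_cnt => l /andP [_ lj].
  by apply: highE; apply: leq_trans jn.
have U1' j : j <= k -> cnt b 0 k + cnt a 0 j <= cnt a 0 k + cnt b 0 j.
  by move=> jk; have := U1 j jk; rewrite (@cnt_cat a j 0 k) ?(@cnt_cat b j 0 k); lia.
have U2' j : k < j -> j <= n ->
    cnt a 0 j + cnt b 0 k.+1 <= cnt a 0 k.+1 + cnt b 0 j.
  move=> kj jn; have := U2 j; rewrite kj jn => /(_ isT).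
  by rewrite (@cnt_cat a k.+1 0 j) ?(@cnt_cat b k.+1 0 j) //; lia.
have split0 (x : pred nat) j l : j <= l -> cnt x j l = cnt x 0 l - cnt x 0 j.
  by move=> jl; rewrite (@cnt_cat x j 0 l) // addKn.
have uAB : unbr_last A B n k.
  split=> // [|j jk|j /andP [kj jn]].
  - by rewrite /A lowE // ak; lia.
  - rewrite !(split0 _ j k) // !cA ?cB; try lia.
    by have := U1' j jk; have := mono b j k jk (ltnW kn); lia.
  - rewrite !(split0 _ k.+1 j) // !cA ?cB; try lia.
    by have := U2' j kj jn; have := mono a j n jn (leqnn _); lia.
have dy : dyck_interval t (i', m).
  apply/(dyck_intervalP i' m (perm_std_word w)); split.
  - by rewrite /i' tk; split=> //; lia.
  - move=> j l jl ln; rewrite !lowE // ?(ltn_trans jl ln) //.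
    move=> /andP [/eqP aj _] /andP [/eqP al _].
    by rewrite std_word_lt // ?(ltn_trans jl ln) // /word_lt aj al jl eqxx orbT.
  - move=> j l jl ln; rewrite !highE // ?(ltn_trans jl ln) //.
    move=> /andP [/eqP aj _] /andP [/eqP al _].
    by rewrite std_word_lt // ?(ltn_trans jl ln) // /word_lt aj al jl eqxx orbT.
  - apply/(bal_eq0 AB) => j jn; rewrite !(split0 _ j n) // !cA ?cB; try lia.
    have := mono a j n jn (leqnn _); case: (leqP j k) => jk.
      by have := U1' j jk; have := mono b j k jk (ltnW kn); lia.
    by have := U2' j jk jn; lia.
split=> //; set v := map (collapse i' m) t.
have st : size t = n by rewrite size_std_word.
have sv : size v = n by rewrite size_map.
have vA l : l < n -> is_i i' v l = A l.
  by move=> ln; rewrite /is_i (nth_map 0) ?st // collapse_i.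
have vB l : l < n -> is_i1 i' v l = B l.
  by move=> ln; rewrite /is_i1 (nth_map 0) ?st // collapse_i1.
have uv : unbr_last (is_i i' v) (is_i1 i' v) n k.
  by apply: eq_unbr_last uAB => l ln; rewrite ?vA ?vB.
exists (set_nth 0 v k i'.+1); first by apply/f_wordP; exists k; rewrite ?sv.
have sd : std_word v = t by apply: std_collapse (perm_std_word w) dy.
case: (uv) => _ /eqP vk _ _; have /eqP wk := ak.
(* Trimming keeps every passed letter: an [i] right of [k] has more than [c'] others before it, and
   an [i+1] left of [k] is among the first [c]. *)
have pas l : l < n -> passed v i' k l = passed w i k l.
  move=> ln; rewrite /passed -/(is_i i' v l) -/(is_i1 i' v l) vA // vB //.
  rewrite /A /B lowE // highE // -/(is_i i w l) -/(is_i1 i w l) -/a -/b.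
  case: (ltngtP k l) => [kl|lk|_] //=.
    by have := mono a k.+1 l kl (ltnW ln); case: (a l) => //=; lia.
  have := mono b l.+1 k lk (ltnW kn); rewrite cntSr //.
  by case: (b l) => //=; lia.
apply: (@eq_from_nth _ 0) => [|l].
  by rewrite !size_std_word !size_set_nth sv.
rewrite size_std_word size_set_nth => ln'; have {ln'}ln : l < n by rewrite /n in kn *; lia.
have [->|lk] := eqVneq l k.
  rewrite (std_raise_at _ wk) // (std_raise_at _ vk) ?sv // sd; congr (_ + _).
  by apply: eq_cnt => j /andP [_ /pas ->].
apply: (@addIn (passed w i k l)); rewrite -std_raise_off //.
by rewrite -pas // -std_raise_off ?sv // sd.
Qed.

End StdValues.

(** * Edges of the crystal skeleton *)

(** Choice extracts a map in each direction from the relation; proof irrelevance reduces equality in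
    the subtypes to equality of the underlying elements. *)
Lemma bij_sig (A B : Type) (P : A -> Prop) (Q : B -> Prop) (R : A -> B -> Prop) :
  (forall x, P x -> exists2 y, Q y & R x y) ->
  (forall y, Q y -> exists2 x, P x & R x y) ->
  (forall x y y', P x -> Q y -> Q y' -> R x y -> R x y' -> y = y') ->
  (forall x x' y, P x -> P x' -> Q y -> R x y -> R x' y -> x = x') ->
  exists f : {x | P x} -> {y | Q y}, bijective f.
Proof.
move=> PQ QP uy ux.
have F (x : {x | P x}) : {y : {y | Q y} | R (sval x) (sval y)}.
  apply: constructive_indefinite_description; case: x => x Px /=.
  by have [y Qy r] := PQ x Px; exists (exist _ y Qy).
have G (y : {y | Q y}) : {x : {x | P x} | R (sval x) (sval y)}.
  apply: constructive_indefinite_description; case: y => y Qy /=.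
  by have [x Px r] := QP y Qy; exists (exist _ x Px).
have sig_inj (C : Type) (S : C -> Prop) (u v : {z | S z}) : sval u = sval v -> u = v.
  case: u v => [u Su] [v Sv] /= e; subst v; congr exist; exact: proof_irrelevance.
exists (fun x => sval (F x)); exists (fun y => sval (G y)) => [x|y]; apply: sig_inj.
  case: (F x) => y r /=; case: (G y) => x' r' /=.
  exact: ux (svalP x') (svalP x) (svalP y) r' r.
case: (G y) => x r /=; case: (F x) => y' r' /=.
exact: uy (svalP x) (svalP y') (svalP y) r' r.
Qed.

Section Edges.
Variables (lam : seq nat) (n : nat).
Hypotheses (pl : is_partition lam) (ln : sumn lam <= n).

Let N := sumn lam.

Lemma perm_row_word T : perm_eq (row_word T) (flatten T).
Proof. by apply: perm_flatten; rewrite perm_rev. Qed.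

Lemma is_SYT_word T : is_SYT lam T <->
  [/\ Defs.shape T = lam, word_tableau lam (row_word T) &
      perm_eq (row_word T) (iota 1 N)].
Proof.
rewrite /is_SYT (permPl (perm_row_word T)); split.
  by case=> ta pT; have [sT _] := ta; split=> //; apply/is_tableauP.
by case=> sT ta pT; split=> //; apply/is_tableauP.
Qed.

Lemma is_SSYT_word T : is_SSYT lam n T <->
  [/\ Defs.shape T = lam, word_tableau lam (row_word T) &
      all (fun x => 1 <= x <= n) (row_word T)].
Proof.
rewrite /is_SSYT (perm_all _ (perm_row_word T)); split.
  by case=> ta pT; have [sT _] := ta; split=> //; apply/is_tableauP.
by case=> sT ta pT; split=> //; apply/is_tableauP.
Qed.

Lemma row_word_inj T T' : Defs.shape T = lam -> Defs.shape T' = lam ->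
  row_word T = row_word T' -> T = T'.
Proof. by move=> sT sT' e; rewrite -(row_wordK sT) e row_wordK. Qed.

Lemma row_word_std b :
  row_word (std b) = std_word (row_word b).
Proof. by apply: tableau_of_wordK; rewrite size_std_word size_row_word. Qed.

Lemma size_set_nth_lt (w : seq nat) k x : k < size w ->
  size (set_nth 0 w k x) = size w.
Proof. by move=> kw; rewrite size_set_nth; apply/maxn_idPr. Qed.

Lemma edge_dyck T T' : CS_edge lam n T T' ->
  exists2 I, dyck_interval (row_word T) I & dyck_step (row_word T) I (row_word T').
Proof.
case=> _ [_ [neT [b [b' [i [_ [/is_SSYT_word [sb _ _] eT] [_ eT'] fb]]]]]].
set w := row_word b; have sw : size w = sumn lam by rewrite size_row_word sb.
move: fb; rewrite /crystal_f sb -/w.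
case fw : (f_word i w) => [w'|//] [eb'].
have [k uk ew'] := (f_wordP i w w').1 fw; have [kw /eqP wk _ _] := uk.
have sw' : size w' = size w by rewrite ew' size_set_nth_lt.
have rT : row_word T = std_word w by rewrite -eT row_word_std.
have rT' : row_word T' = std_word w'.
  by rewrite -eT' -eb' row_word_std tableau_of_wordK // sw'.
rewrite rT rT' ew'; set m := cnt (is_i1 i w) 0 k + cnt (is_i i w) k.+1 (size w).
(* If no letter is passed, raising leaves the standardization unchanged, against [T <> T']. *)
have m0 : 0 < m.
  rewrite lt0n; apply/negP => /eqP m0; case: neT; rewrite -eT -eT' -eb'.
  rewrite /std shape_tableau_of_word ?sw' // sb tableau_of_wordK ?sw' //.
  rewrite -/w; congr tableau_of_word; apply: (@eq_from_nth _ 0).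
    by rewrite !size_std_word sw'.
  rewrite size_std_word => l lw; have cm := cnt_passed w i kw.
  rewrite -/m m0 in cm; rewrite ew'; have [->|lk] := eqVneq l k.
    by rewrite (std_raise_at _ wk) // cm addn0.
  rewrite (std_raise_off kw wk) //.
  case pw: (passed w i k l); last by rewrite addn0.
  by have := @cnt_gt0 (passed w i k) 0 (size w) l lw pw; rewrite cm.
by have [dy ds] := unbr_dyck uk m0; exists (nth 0 (std_word w) k -
  cnt (is_i1 i w) 0 k, m).
Qed.

Lemma dyck_edge T I : is_SYT lam T -> dyck_interval (row_word T) I ->
  exists2 T', CS_edge lam n T T' & dyck_step (row_word T) I (row_word T').
Proof.
case: I => i m sytT dy; have [sT ta pt] := (is_SYT_word T).1 sytT.
have [[i0 m0 imN] _ _ _] := (dyck_intervalP i m pt).1 dy.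
set t := row_word T in ta pt dy *; set w := map (collapse i m) t.
have st : size t = N by rewrite size_row_word sT.
have sw : size w = N by rewrite size_map.
have sd : std_word w = t := std_collapse pt dy.
have [k [uk _ cm]] := dyck_unbr pt dy.
have [kN /eqP wk _ _] := uk; set w' := set_nth 0 w k i.+1.
have sw' : size w' = N by rewrite size_set_nth_lt sw.
have fw : f_word i w = Some w' by apply/f_wordP; exists k; rewrite ?sw.
have taw : word_tableau lam w by apply/word_tableau_std; rewrite ?sd.
have taw' : word_tableau lam w'.
  by apply: word_tableau_raise => //; rewrite sw.
have ds : dyck_step t (i, m) (std_word w') by exists w'.
have okw : all (fun x => 1 <= x <= n) w.
  apply/(all_nthP 0) => l; rewrite sw => lN; rewrite (nth_map 0) ?st //.
  have := perm_iota_range pt lN; rewrite /collapse /low /high /N.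
  by move: imN ln; rewrite -/N; do ![case: ifP]; lia.
exists (tableau_of_word lam (std_word w')); last first.
  by rewrite tableau_of_wordK // size_std_word sw'.
have sytT' : is_SYT lam (tableau_of_word lam (std_word w')).
  apply/is_SYT_word; rewrite shape_tableau_of_word ?tableau_of_wordK;
    rewrite ?size_std_word //.
  split=> //; first by apply/word_tableau_std.
  by rewrite -sw'; apply: perm_std_word.
split=> //; split=> //; split.
  (* The two tableaux differ because the entry at [k] grows by [m > 0]. *)
  move=> eT; have := std_raise_at (w := w) (i := i) (k := k).
  rewrite sw => /(_ kN wk); rewrite -/w' sd cm.
  by rewrite /t eT tableau_of_wordK ?size_std_word //; lia.
exists (tableau_of_word lam w), (tableau_of_word lam w'), i; split.
(* From [i + 2 * m <= N <= n] and [0 < m]. *)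
- by rewrite i0 /=; apply: leq_trans ln; rewrite -/N; lia.
- rewrite /std shape_tableau_of_word // tableau_of_wordK // sd row_wordK //.
  by split=> //; apply/is_SSYT_word; rewrite shape_tableau_of_word ?tableau_of_wordK.
- rewrite /std shape_tableau_of_word // tableau_of_wordK //; split=> //.
  apply/is_SSYT_word; rewrite shape_tableau_of_word ?tableau_of_wordK //.
  split=> //; apply/(all_nthP 0) => l; rewrite sw' => lN; rewrite nth_set_nth /=.
  case: ifP => _; last by apply: (all_nthP 0 okw); rewrite sw.
  by move: imN ln; rewrite /N; lia.
- by rewrite /crystal_f shape_tableau_of_word // tableau_of_wordK // fw.
Qed.

Lemma dyck_step_det t I t1 t2 : dyck_step t I t1 -> dyck_step t I t2 -> t1 = t2.
Proof. by case=> w1 f1 -> [w2]; rewrite f1 => -[->] ->. Qed.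

Lemma edge_unique T T1 T2 I : CS_edge lam n T T1 -> CS_edge lam n T T2 ->
  dyck_step (row_word T) I (row_word T1) ->
  dyck_step (row_word T) I (row_word T2) -> T1 = T2.
Proof.
case=> _ [/is_SYT_word [s1 _ _] _] [_ [/is_SYT_word [s2 _ _] _]] d1 d2.
exact: row_word_inj s1 s2 (dyck_step_det d1 d2).
Qed.

Lemma interval_unique T T' I1 I2 : is_SYT lam T ->
  dyck_interval (row_word T) I1 -> dyck_interval (row_word T) I2 ->
  dyck_step (row_word T) I1 (row_word T') ->
  dyck_step (row_word T) I2 (row_word T') -> I1 = I2.
Proof. by move=> /is_SYT_word [_ _ pt]; apply: dyck_step_inj pt. Qed.

End Edges.

Theorem theorem3p9 (lam : seq nat) (n : nat) :
  is_partition lam -> sumn lam <= n ->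
  (forall T : tableau, is_SYT lam T ->
     exists f : {T' : tableau | CS_edge lam n T T'} ->
                {I : nat * nat | dyck_interval (row_word T) I},
       bijective f)
  /\
  (exists g : {e : tableau * tableau | CS_edge lam n e.1 e.2} ->
              {p : tableau * (nat * nat) |
                 is_SYT lam p.1 /\ dyck_interval (row_word p.1) p.2},
     bijective g).
Proof.
move=> pl ln; split=> [T sT|].
  apply: (bij_sig (R := fun T' I => dyck_step (row_word T) I (row_word T'))).
  - by move=> T'; exact: (edge_dyck pl).
  - by move=> I; exact: (dyck_edge pl ln sT).
  - by move=> T' I1 I2 _; exact: (interval_unique pl sT).
  - by move=> T1 T2 I e1 e2 _; exact: (edge_unique pl e1 e2).
(* The same correspondence, fibred over the common source tableau. *)
apply: (bij_sig (R := fun e p => e.1 = p.1 /\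
  dyck_step (row_word e.1) p.2 (row_word e.2))).
- move=> [T T'] /= e; have [I dy ds] := edge_dyck pl e.
  by exists (T, I) => //; split=> //; case: e.
- move=> [T I] /= [sT dy]; have [T' e ds] := dyck_edge pl ln sT dy.
  by exists (T, T').
- move=> [T T'] [T1 I1] [T2 I2] /= _ [s1 d1] [_ d2] [e1 r1] [e2 r2]; subst T1 T2.
  by congr (_, _); exact: (interval_unique pl s1 d1 d2 r1 r2).
- move=> [T1 T1'] [T2 T2'] [T I] /= h1 h2 _ [e1 r1] [e2 r2]; subst T1 T2.
  by congr (_, _); exact: (edge_unique pl h1 h2 r1 r2).
Qed.
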